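(* Let $G=(V,E)$ be an oriented interval catch digraph with $n=|V|\geq 1$. Then $G$ is a tournament if and only if there is an ordering $v_1,v_2,\ldots,v_n$ of the vertices of $G$ with respect to which the augmented adjacency matrix $A^{*}(G)$ takes one of the following two forms: $$A^{*}(G)=\left[\begin{array}{c|c} M & F\\ \hline \overline{F^{T}} & N\end{array}\right]\qquad\text{or}\qquad A^{*}(G)=P,$$ where, for some $1\le l\le n$ (the blocks $F$, $\overline{F^T}$, $N$ being absent if $l=n$), $M$ is the $l\times l$ upper triangular matrix with all entries on and above the principal diagonal equal to $1$ and all other entries $0$; $N$ is the $(n-l)\times(n-l)$ and $P$ the $n\times n$ lower triangular matrix with all entries on and below the principal diagonal equal to $1$ and all other entries $0$; and $F$ is an $l\times(n-l)$ Ferrers matrix whose $1$'s are clustered in its upper left corner.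
   Context: Digraphs are finite and simple (no loops, no multiple arcs). A digraph $G=(V,E)$ is an interval catch digraph (ICD) if one can assign to each $u\in V$ a closed bounded interval $I_u$ of the real line and a point $p_u\in I_u$ such that for $u,v\in V$: $uv\in E$ if and only if $u\ne v$ and $p_v\in I_u$. An oriented ICD is an ICD with no pair $u,v$ such that both $uv\in E$ and $vu\in E$. A tournament is a digraph in which for each pair of distinct vertices $u,v$ exactly one of $uv,vu$ is an arc. The augmented adjacency matrix $A^*(G)$ with respect to an ordering $v_1,\dots,v_n$ of $V$ is the $n\times n$ $(0,1)$-matrix, rows and columns both indexed in this order, whose $(i,j)$ entry is $1$ if and only if $i=j$ or $v_iv_j\in E$. For a $(0,1)$-matrix $X$, $\overline{X}$ is the matrix obtained by interchanging $0$'s and $1$'s. A $(0,1)$-matrix is a Ferrers matrix if its $1$'s are clustered in a corner; for the upper left corner this means: if an entry is $1$, then every entry weakly above it and weakly to the left of it is $1$ (so each row has its $1$'s in an initial segment and the numbers of $1$'s in the rows are non-increasing from top to bottom; zero rows are allowed). *)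

(* Defs.v *)
From HB Require Import structures.
From mathcomp Require Import all_boot all_order all_algebra.
From mathcomp Require Import reals.

Set Implicit Arguments.
Unset Strict Implicit.
Unset Printing Implicit Defensive.

Import Order.TTheory GRing.Theory Num.Theory.

Local Open Scope ring_scope.

Record digraph := Digraph {
  vertex :> finType;
  arc : rel vertex;
  arc_irreflexive : irreflexive arc }.

Definition interval_catch_digraph (R : realType) (G : digraph) : Prop :=
  exists (a b p : G -> R),
    (forall u : G, p u \in `[a u, b u]) /\
    (forall u v : G, arc u v = (u != v) && (p v \in `[a u, b u])).

Definition oriented (G : digraph) : Prop :=
  forall u v : G, ~~ (arc u v && arc v u).

Definition oriented_ICD (R : realType) (G : digraph) : Prop :=
  interval_catch_digraph R G /\ oriented G.

Definition tournament (G : digraph) : Prop :=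
  forall u v : G, u != v -> arc u v (+) arc v u.

(* (0,1)-matrices are matrices over bool, with 1 read as true and 0 as false. *)

Definition augmented_adjacency (G : digraph) (n : nat) (v : 'I_n -> G) :
    'M[bool]_n :=
  \matrix_(i, j) ((i == j) || arc (v i) (v j)).

Definition compl_mx (m n : nat) (X : 'M[bool]_(m, n)) : 'M[bool]_(m, n) :=
  map_mx negb X.

Definition upper_ones (n : nat) : 'M[bool]_n := \matrix_(i, j) (i <= j)%N.

Definition lower_ones (n : nat) : 'M[bool]_n := \matrix_(i, j) (j <= i)%N.

Definition Ferrers_upper_left (m n : nat) (F : 'M[bool]_(m, n)) : Prop :=
  forall (i i' : 'I_m) (j j' : 'I_n),
    (i' <= i)%N -> (j' <= j)%N -> F i j -> F i' j'.

(* The cast only identifies the index types 'I_(l + (n - l)) and 'I_n; for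
   l = n the blocks involving F and N have a dimension equal to 0. *)
Definition block_form (n : nat) (A : 'M[bool]_n) : Prop :=
  exists (l : nat) (le_ln : (l <= n)%N) (F : 'M[bool]_(l, n - l)),
    [/\ (1 <= l)%N,
        Ferrers_upper_left F
      & A = castmx (subnKC le_ln, subnKC le_ln)
              (block_mx (upper_ones l)     F
                        (compl_mx F^T)     (lower_ones (n - l)))].

(* Main.v *)
Require Import Defs.
From HB Require Import structures.
From mathcomp Require Import all_boot all_order all_algebra.
From mathcomp Require Import reals.

Set Implicit Arguments.
Unset Strict Implicit.
Unset Printing Implicit Defensive.

(** List the vertices by increasing points [p_v].  Then the 1's of each row of
    the augmented adjacency matrix [A] are consecutive and contain the diagonal
    entry.  In a tournament [A i j = ~~ A j i] off the diagonal, so applying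
    this to the rows below the diagonal shows that the 1's strictly above the
    diagonal are closed under moving left or up.  Take [l] maximal such that
    the leading [l x l] block is upper triangular of 1's.  A 1 in position
    [(i, j)] with [l <= i < j] would give a 1 in position [(i, i + 1)], hence a
    larger such block; so the last block is lower triangular of 1's.  Thus the
    block form always occurs, [P] being its special case [l = 1], [F = 0]. *)

Import Order.TTheory.

Definition tournament_mx (n : nat) (A : 'M[bool]_n) : Prop :=
  forall i j : 'I_n, i != j -> A i j (+) A j i.

Lemma tournament_augmented_adjacency (G : digraph) (n : nat) (v : 'I_n -> G) :
  bijective v -> tournament G <-> tournament_mx (augmented_adjacency v).
Proof.
move=> bij_v; have inj_v := bij_inj bij_v.
have adjE i j : i != j -> augmented_adjacency v i j = Defs.arc (v i) (v j).
  by move=> /negPf neq_ij; rewrite mxE neq_ij.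
split=> [tG i j neq_ij | tA x y].
  by rewrite (adjE i j) // (adjE j i) 1?eq_sym //; apply: tG; rewrite inj_eq.
have [w wK vK] := bij_v; rewrite -(vK x) -(vK y) (inj_eq inj_v) => neq_xy.
by rewrite -adjE // -adjE 1?eq_sym //; apply: tA.
Qed.

Lemma tournament_lower_ones (n : nat) : tournament_mx (lower_ones n).
Proof. by move=> i j; rewrite !mxE neq_ltn => /orP[]; case: ltngtP. Qed.

Lemma tournament_upper_ones (n : nat) : tournament_mx (upper_ones n).
Proof. by move=> i j; rewrite !mxE neq_ltn => /orP[]; case: ltngtP. Qed.

(** Mirror positions in [F] and [compl_mx F^T] carry complementary entries, and the two diagonal
    blocks are triangular matrices of 1's. *)
Lemma tournament_block_form (n : nat) (A : 'M[bool]_n) :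
  block_form A -> tournament_mx A.
Proof.
case=> l [le_ln [F [_ _ ->]]] i j; rewrite !castmxE /=.
(* Injectivity of the cast carries [i != j] over to the indices of the block matrix. *)
rewrite -(inj_eq (@cast_ord_inj _ _ (esym (subnKC le_ln)))).
move: (cast_ord _ i) (cast_ord _ j) => {}i {}j.
case: (split_ordP i) => i' ->; case: (split_ordP j) => j' ->.
- rewrite (inj_eq (@lshift_inj _ _)) !block_mxEul.
  exact: tournament_upper_ones.
- by rewrite block_mxEur block_mxEdl !mxE addbN addbb.
- by rewrite block_mxEur block_mxEdl !mxE addNb addbb.
- rewrite (inj_eq (@rshift_inj _ _)) !block_mxEdr.
  exact: tournament_lower_ones.
Qed.

Lemma block_form_of_consecutive_ones (n : nat) (A : 'M[bool]_n) :
  (0 < n)%N -> tournament_mx A -> (forall i, A i i) ->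
  (forall i j k : 'I_n, (i <= k <= j)%N || (j <= k <= i)%N -> A i j -> A i k) ->
  block_form A.
Proof.
move=> n_gt0 tA diagA rowA.
have skewA (i j : 'I_n) : (i < j)%N -> A j i = ~~ A i j.
  move=> lt_ij; have /tA : i != j by rewrite neq_ltn lt_ij.
  by case: (A i j); case: (A j i).
have leftA (i j k : 'I_n) : (i <= k <= j)%N -> A i j -> A i k.
  by move=> le_ikj; apply: rowA; rewrite le_ikj.
have upA (i j k : 'I_n) : (k <= i < j)%N -> A i j -> A k j.
  (* Transposed argument: a 0 at [(k, j)] is a 1 at [(j, k)], which row [j] spreads towards its
     diagonal to [(j, i)], so [(i, j)] holds a 0. *)
  case/andP=> le_ki lt_ij; apply: contraTT.
  rewrite -!skewA ?(leq_ltn_trans le_ki) //.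
  by apply: rowA; rewrite le_ki (ltnW lt_ij) orbT.
have cornerA (i j i' j' : 'I_n) :
    (i' <= i < j)%N -> (i' <= j' <= j)%N -> A i j -> A i' j'.
  by move=> le_i le_j Aij; apply: leftA le_j _; apply: upA Aij.
(* Only entries strictly above the diagonal are tested; [diagA] and [skewA] determine the rest of
   the block. *)
pose full l := (l <= n)%N &&
  [forall i : 'I_n, forall j : 'I_n, (i < j < l)%N ==> A i j].
have full1 : full 1%N.
  rewrite /full n_gt0; apply/forallP=> i; apply/forallP=> j.
  by apply/implyP; case: (j : nat) => [|m]; rewrite ?ltn0 ?andbF.
have bound l : full l -> (l <= n)%N by case/andP.
have [l /andP[le_ln /forallP fullA] maxl] :=
  ex_maxnP (ex_intro full _ full1) bound.
have ulA (i j : 'I_n) : (i < j < l)%N -> A i j.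
  by move=> lt_ijl; have /forallP/(_ j)/implyP := fullA i; apply.
have drA (i j : 'I_n) : (l <= i < j)%N -> ~~ A i j.
  case/andP=> le_li lt_ij; apply/negP=> Aij.
  (* Indices [i' < j' < i.+2] satisfy [i' <= i] and [j' <= i.+1 <= j], so [cornerA] fills the whole
     block from [A i j], while [l < i.+2]. *)
  suff /maxl : full i.+2 by rewrite leqNgt ltnS leqW.
  rewrite /full (leq_ltn_trans lt_ij) //.
  apply/forallP=> i'; apply/forallP=> j'; apply/implyP=> /andP[lt_ij' le_j'i].
  apply: cornerA Aij; first by rewrite lt_ij andbT -ltnS (leq_trans lt_ij').
  by rewrite ltnW //= (leq_trans _ lt_ij).
pose e := subnKC le_ln.
pose B := castmx (esym e, esym e) A.
have BE i j : B i j = A (cast_ord e i) (cast_ord e j).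
  by rewrite castmxE !esymK.
exists l, le_ln, (ursubmx B); split; first exact: maxl.
  (* Columns of [F] are shifted by [l], so all its entries lie strictly above the diagonal of [A],
     where [cornerA] applies. *)
  move=> i i' j j' le_i le_j; rewrite !mxE !BE; apply: cornerA => /=.
    by rewrite le_i ltn_addr.
  by rewrite ltnW ?ltn_addr //= leq_add2l.
rewrite -[LHS](castmxKV e e) -/B; congr castmx; rewrite -[LHS]submxK.
congr block_mx; apply/matrixP=> i j; rewrite !mxE !BE.
- have [le_ij|lt_ji] := leqP i j; last by rewrite skewA // ulA //= lt_ji /=.
  move: le_ij; rewrite leq_eqVlt => /predU1P[/val_inj ->|lt_ij].
    exact: diagA.
  by rewrite ulA //= lt_ij /=.
- by rewrite skewA //= ltn_addr.
- have [le_ji|lt_ij] := leqP j i; last first.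
    by apply/negbTE/drA; rewrite /= leq_addr ltn_add2l.
  move: le_ji; rewrite leq_eqVlt => /predU1P[/val_inj ->|lt_ji].
    exact: diagA.
  by rewrite skewA ?drA //= ?leq_addr ltn_add2l.
Qed.

Lemma exists_nondecreasing_enumeration (disp : Order.disp_t)
    (K : orderType disp) (T : finType) (p : T -> K) (n : nat) :
  #|T| = n -> (0 < n)%N ->
  exists v : 'I_n -> T,
    bijective v /\ forall i j : 'I_n, (i <= j)%N -> (p (v i) <= p (v j))%O.
Proof.
move=> card_T n_gt0; pose r := [rel x y | (p x <= p y)%O].
pose s := sort r (enum T).
have size_s : size s = n by rewrite size_sort -cardE.
have uniq_s : uniq s by rewrite sort_uniq enum_uniq.
have tr_r : transitive r by move=> y x z; apply: le_trans.
have sorted_s : sorted r s by apply: sort_sorted => x y; apply: le_total.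
(* A default element for [nth], available because [T] has [n > 0] elements. *)
have x0 : T by apply: (@enum_val T T); rewrite card_T; apply: Ordinal n_gt0.
exists (fun i => nth x0 s i); split.
  apply: inj_card_bij; last by rewrite card_T card_ord.
  by move=> i j /eqP; rewrite nth_uniq ?size_s // => /eqP/val_inj.
move=> i j; apply: (sorted_leq_nth tr_r _ x0 sorted_s); rewrite ?inE ?size_s //.
by move=> x; apply: lexx.
Qed.

Theorem theorem6p6 (R : realType) (G : digraph) (n : nat)
    (card_G : #|G| = n) (n_ge1 : (1 <= n)%N) (icd_G : oriented_ICD R G) :
  tournament G <->
  exists v : 'I_n -> G,
    bijective v /\
    (block_form (augmented_adjacency v) \/
     augmented_adjacency v = lower_ones n).
Proof.
split=> [tG | [v [bij_v formA]]]; last first.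
  apply/(tournament_augmented_adjacency bij_v).
  case: formA => [|->]; first exact: tournament_block_form.
  exact: tournament_lower_ones.
case: icd_G => -[a [b [p [p_in arcE]]]] _.
have [v [bij_v le_pv]] := exists_nondecreasing_enumeration p card_G n_ge1.
have adjE i j : augmented_adjacency v i j = (p (v j) \in `[a (v i), b (v i)]%R).
  rewrite mxE arcE (inj_eq (bij_inj bij_v)).
  by have [->|] := eqVneq i j; rewrite ?p_in.
exists v; split=> //; left; apply: block_form_of_consecutive_ones => //.
- exact/(tournament_augmented_adjacency bij_v).
- by move=> i; rewrite adjE p_in.
move=> i j k le_ijk; rewrite !adjE => pj_in.
(* The interval of [v i] contains [p (v i)] and [p (v j)], hence also [p (v k)], which lies between
   them. *)
have:= pj_in; have:= p_in (v i); rewrite !in_itv /=.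
case/andP=> ai ib /andP[aj jb].
case/orP: le_ijk => /andP[/le_pv le1 /le_pv le2].
  by rewrite (le_trans ai le1) (le_trans le2 jb).
by rewrite (le_trans aj le1) (le_trans le2 ib).
Qed.
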